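(* Fix an integer $d \ge 1$. The parameterized problem $d$-Tracking Set (parameter $k$) admits a polynomial kernel (a kernel whose size is bounded by a polynomial in $k$, for fixed $d$), and it can be solved by an FPT algorithm running in time $\mathcal{O}^*(c^k)$, where $c$ is a polynomial function of $d$.
   Context: A set system is a pair $(X,\mathcal{S})$ with $X$ a finite set and $\mathcal{S}$ a family of subsets of $X$. A tracking set for $(X,\mathcal{S})$ is a set $T \subseteq X$ such that for any two distinct $S_i,S_j \in \mathcal{S}$, $S_i \cap T \neq S_j \cap T$. The problem $d$-Tracking Set: given a set system $(X,\mathcal{S})$ in which every $S \in \mathcal{S}$ satisfies $|S| \le d$, and an integer $k$ (the parameter), decide whether there is a tracking set $T$ with $|T| \le k$. A kernel is a polynomial-time algorithm mapping an instance $(x,k)$ to an equivalent instance of the same problem whose size is bounded by a computable function of $k$. $\mathcal{O}^*$ suppresses factors polynomial in the input size. *)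

(* Defs.v *)
From mathcomp Require Import all_boot all_order all_algebra.

Set Implicit Arguments.
Unset Strict Implicit.
Unset Printing Implicit Defensive.

(* The model of computation is Jones' WHILE language (N. D. Jones,
   Computability and Complexity from a Programming Perspective) over binary
   trees, with an added conditional and with its usual unit-cost time measure.
   It is polynomial-time equivalent to Turing machines: a store reached after t
   steps is represented, with sharing of subtrees, by a DAG with at most t
   nodes more than the input, and a test only inspects the root of a tree. *)

Inductive tree : Type :=
  | Nil
  | Cons of tree & tree.

Fixpoint tsize (x : tree) : nat :=
  if x is Cons y z then (tsize y + tsize z).+1 else 1.

Inductive expr : Type :=
  | EVar of nat
  | ENil
  | ECons of expr & expr
  | EHd of expr
  | ETl of expr.

Inductive cmd : Type :=
  | Assign of nat & expr
  | Seq of cmd & cmd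
  | If of expr & cmd & cmd
  | While of expr & cmd.

Definition store : Type := nat -> tree.

Fixpoint eval (s : store) (e : expr) : tree :=
  match e with
  | EVar v => s v
  | ENil => Nil
  | ECons e1 e2 => Cons (eval s e1) (eval s e2)
  | EHd e1 => if eval s e1 is Cons y _ then y else Nil
  | ETl e1 => if eval s e1 is Cons _ z then z else Nil
  end.

Fixpoint ecost (e : expr) : nat :=
  match e with
  | EVar _ | ENil => 1
  | ECons e1 e2 => (ecost e1 + ecost e2).+1
  | EHd e1 | ETl e1 => (ecost e1).+1
  end.

Definition truth (x : tree) : bool := if x is Cons _ _ then true else false.

(* exec c s t s' : started in the store s, the command c terminates in the
   store s' after exactly t steps. *)
Inductive exec : cmd -> store -> nat -> store -> Prop :=
  | exec_assign v e s :
      exec (Assign v e) s (ecost e).+1 [eta s with v |-> eval s e]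
  | exec_seq c1 c2 s1 s2 s3 t1 t2 :
      exec c1 s1 t1 s2 -> exec c2 s2 t2 s3 ->
      exec (Seq c1 c2) s1 (t1 + t2).+1 s3
  | exec_if e c1 c2 s s' t :
      exec (if truth (eval s e) then c1 else c2) s t s' ->
      exec (If e c1 c2) s (ecost e + t).+1 s'
  | exec_while_false e c s :
      ~~ truth (eval s e) -> exec (While e c) s (ecost e).+1 s
  | exec_while_true e c s1 s2 s3 t1 t2 :
      truth (eval s1 e) -> exec c s1 t1 s2 -> exec (While e c) s2 t2 s3 ->
      exec (While e c) s1 (ecost e + t1 + t2).+1 s3.

(* Input and output are passed in variable 0. *)
Definition runs (c : cmd) (x : tree) (t : nat) (y : tree) : Prop :=
  exists2 s : store, exec c [fun _ : nat => Nil with 0 |-> x] t s & s 0 = y.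

Definition code_bool (b : bool) : tree := if b then Cons Nil Nil else Nil.

Definition code_seq (s : seq tree) : tree := foldr Cons Nil s.

(* Unary. *)
Definition code_nat (n : nat) : tree := code_seq (nseq n Nil).

(* An instance may have several codes: an algorithm has to work on all of
   them, and may output any of them. *)
Record param_problem : Type := ParamProblem {
  instance : Type;
  is_code : instance -> tree -> Prop;
  parameter : instance -> nat;
  is_yes : instance -> Prop }.

Definition has_polynomial_kernel (P : param_problem) : Prop :=
  exists (c : cmd) (p q : {poly nat}),
    forall (I : instance P) (x : tree), is_code I x ->
    exists (t : nat) (I' : instance P) (x' : tree),
      [/\ is_code I' x',
          runs c x t x',
          t <= p.[tsize x]%R,
          is_yes I <-> is_yes I' &
          tsize x' + parameter I' <= q.[parameter I]%R].

(* Decidable in time O*(f(k)), k being the parameter. *)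
Definition solvable_in_Ostar (P : param_problem) (f : nat -> nat) : Prop :=
  exists (c : cmd) (q : {poly nat}),
    forall (I : instance P) (x : tree), is_code I x ->
    exists (t : nat) (b : bool),
      [/\ runs c x t (code_bool b),
          is_yes I <-> b &
          t <= f (parameter I) * q.[tsize x]%R].

Definition tracking (X : finType) (F : {set {set X}}) (T : {set X}) : Prop :=
  forall A B : {set X}, A \in F -> B \in F -> A <> B -> A :&: T <> B :&: T.

(* The ground set of an instance is {0, ..., points - 1}. *)
Record tracking_instance (d : nat) : Type := TrackingInstance {
  points : nat;
  family : {set {set 'I_points}};
  family_bound : forall A : {set 'I_points}, A \in family -> #|A| <= d;
  budget : nat }.

Definition code_set (n : nat) (A : {set 'I_n}) : tree :=
  code_seq [seq code_bool (i \in A) | i <- enum 'I_n].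

(* The ground set and the budget are coded in unary, and the family by its
   incidence matrix, the members being listed without repetition in any order.
   As the ground set is part of the input, this is polynomially related to
   listing the elements of each member. *)
Definition tracking_code (d : nat) (I : tracking_instance d) (x : tree) : Prop :=
  exists2 r : seq {set 'I_(points I)}, perm_eq r (enum (family I)) &
    x = Cons (code_nat (points I))
          (Cons (code_seq [seq code_set A | A <- r]) (code_nat (budget I))).

Definition tracking_yes (d : nat) (I : tracking_instance d) : Prop :=
  exists2 T : {set 'I_(points I)}, tracking (family I) T & #|T| <= budget I.

Definition tracking_set_problem (d : nat) : param_problem :=
  {| instance := tracking_instance d;
     is_code := @tracking_code d;
     parameter := @budget d;
     is_yes := @tracking_yes d |}.

(* Main.v *)
Require Import Defs.
From mathcomp Require Import all_boot all_order all_algebra.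
From mathcomp Require Import zify.
Import Defs.

Set Implicit Arguments.
Unset Strict Implicit.
Unset Printing Implicit Defensive.

(** A set tracks the family iff it meets the symmetric difference of any two
    members, which has at most 2d points.

    Algorithm: as long as two members A and B have the same trace on T, branch
    on the point of their symmetric difference to be added to T. The search
    tree has depth k and degree at most 2d.

    Kernel: if T is a tracking set of size at most k, the traces of the members
    are pairwise distinct subsets of T of size at most d, and there are at most
    (k+1)^d of those. Hence a larger family is a no-instance; otherwise the
    union of the family has at most d(k+1)^d points, and all other points can
    be dropped. *)

(** * Weakest preconditions for the WHILE language *)

(** Termination is built in, and the postcondition also sees the exact number of steps, so
    correctness and running time are proved together. *)
Definition wp (c : cmd) (s : store) (Q : nat -> store -> Prop) : Prop :=
  exists t s', exec c s t s' /\ Q t s'.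

Definition upd (s : store) (v : nat) (x : tree) : store :=
  fun w => if w == v then x else s w.
Arguments upd s v x w /.

Fixpoint writes (c : cmd) : seq nat :=
  match c with
  | Assign v _ => [:: v]
  | Seq c1 c2 | If _ c1 c2 => writes c1 ++ writes c2
  | While _ c1 => writes c1
  end.

Lemma exec_frame c s t s' :
  exec c s t s' -> forall v, v \notin writes c -> s' v = s v.
Proof.
elim=> {c s t s'} //=.
- by move=> v e s w; rewrite inE => /negPf ->.
- move=> c1 c2 s1 s2 s3 t1 t2 _ IH1 _ IH2 v; rewrite mem_cat negb_or.
  by case/andP=> h1 h2; rewrite IH2 ?IH1.
- move=> e c1 c2 s s' t _ IH v; rewrite mem_cat negb_or => /andP[h1 h2].
  by apply: IH; case: (truth _).
- by move=> e c s1 s2 s3 t1 t2 _ _ IH1 _ IH2 v h; rewrite IH2 ?IH1.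
Qed.

(** Hands the frame to the caller, so that a specification has to mention only the variables that
    carry its result. *)
Lemma wp_call c s (Q Q' : nat -> store -> Prop) :
    wp c s Q ->
    (forall t s', (forall v, v \notin writes c -> s' v = s v) ->
       Q t s' -> Q' t s') ->
  wp c s Q'.
Proof.
move=> [t [s' [ex q]]] QQ'; exists t, s'; split=> //.
exact: QQ' (exec_frame ex) q.
Qed.

Lemma wp_assign v e s (Q : nat -> store -> Prop) :
  Q (ecost e).+1 (upd s v (eval s e)) -> wp (Assign v e) s Q.
Proof. by move=> q; exists (ecost e).+1; eexists; split; first exact: exec_assign. Qed.

Lemma wp_seq c1 c2 s (Q : nat -> store -> Prop) :
    wp c1 s (fun t1 s1 => wp c2 s1 (fun t2 s2 => Q (t1 + t2).+1 s2)) ->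
  wp (Seq c1 c2) s Q.
Proof.
move=> [t1 [s1 [e1 [t2 [s2 [e2 q]]]]]]; exists (t1 + t2).+1, s2; split=> //.
exact: exec_seq e1 e2.
Qed.

Lemma wp_if e c1 c2 s (Q : nat -> store -> Prop) :
    wp (if truth (eval s e) then c1 else c2) s
      (fun t s' => Q (ecost e + t).+1 s') ->
  wp (If e c1 c2) s Q.
Proof.
by move=> [t [s' [ex q]]]; exists (ecost e + t).+1, s'; split=> //; exact: exec_if.
Qed.

(** The measure [m] is a ghost parameter of the invariant, not a function of the store, and may drop
    by more than one in a round. The last summand of the bound pays for the final, failing test. *)
Lemma wp_while (I : nat -> store -> Prop) B e c s m :
    I m s ->
    (forall m s, I m s -> truth (eval s e) ->
       wp c s (fun t s' => t <= B /\ exists2 m', m' < m & I m' s')) ->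
  wp (While e c) s (fun t s' =>
    [/\ t <= m * (B + ecost e).+1 + (ecost e).+1, ~~ truth (eval s' e)
      & exists m', I m' s']).
Proof.
move=> Is step; have [n] := ubnP m; elim: n => // n IH in m s Is * => le_mn.
have [tr|fa] := boolP (truth (eval s e)); last first.
  exists (ecost e).+1, s; split; first exact: exec_while_false.
  by split=> //; [lia | exists m].
have [t1 [s1 [e1 [t1B [m' m'm I']]]]] := step _ _ Is tr.
have [|t2 [s2 [e2 [t2B fa J]]]] := IH _ _ I'; first by lia.
exists (ecost e + t1 + t2).+1, s2; split; first exact: exec_while_true e1 e2.
by split=> //; nia.
Qed.

(** The ghost list of items still to be visited serves as the measure: each round consumes its
    head. *)
Lemma wp_foreach (A : Type) (I : seq A -> store -> Prop) B e c s xs :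
    I xs s ->
    (forall s, I [::] s -> ~~ truth (eval s e)) ->
    (forall x xs s, I (x :: xs) s -> truth (eval s e) /\
       wp c s (fun t s' => t <= B /\ I xs s')) ->
  wp (While e c) s (fun t s' =>
    t <= size xs * (B + ecost e).+1 + (ecost e).+1 /\ I [::] s').
Proof.
move=> Is stop step.
pose J m s := exists2 ys, size ys = m & I ys s.
have Js : J (size xs) s by exists xs.
have [|t [s' [ex [tB fa [m' [[|y ys] _ I']]]]]] :=
  wp_while (B := B) (e := e) (c := c) Js.
- move=> m s1 [[|y ys] sz I1] tr; first by move: (stop _ I1); rewrite tr.
  have [_ [t [s' [ex [tB I']]]]] := step _ _ _ I1.
  by exists t, s'; split=> //; split=> //; exists (size ys); [rewrite -sz | exists ys].
- by exists t, s'.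
- by have [tr _] := step _ _ _ I'; rewrite tr in fa.
Qed.

(* Matching on the goal keeps named commands from being unfolded. *)
Ltac steps :=
  repeat lazymatch goal with
  | |- wp (Seq _ _) _ _ => apply: wp_seq
  | |- wp (Assign _ _) _ _ => apply: wp_assign
  end; rewrite /=.

Local Notation "$ v" := (EVar v) (at level 0, v at level 0, format "$ v").
Local Notation etrue := (ECons ENil ENil).

Local Notation "c1 ;; c2" := (Seq c1 c2) (at level 75, right associativity).

(** The part of a row that lies over the points in [l]. For [enum 'I_n] it is [code_set A], so loop
    invariants can speak of the unread rest of a row. *)
Definition bits n (A : {set 'I_n}) (l : seq 'I_n) : tree :=
  code_seq [seq code_bool (i \in A) | i <- l].

Lemma truth_code_bool b : truth (code_bool b) = b. Proof. by case: b. Qed.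

(** Lists are accessible only at the head; a row is rebuilt by pushing its reversed prefix back onto
    the rest. *)
Definition CatRev (v w : nat) : cmd :=
  While $v (Assign w (ECons (EHd $v) $w) ;; Assign v (ETl $v)).

Lemma wp_CatRev v w s xs ys : v != w ->
    s v = code_seq xs -> s w = code_seq ys ->
  wp (CatRev v w) s (fun t s' =>
    [/\ t <= size xs * 11 + 2, s' v = Nil & s' w = code_seq (catrev xs ys)]).
Proof.
move=> /negPf vw sv sw.
apply: (wp_call (wp_foreach (B := 9) (xs := xs) (I := fun zs s =>
  s v = code_seq zs /\ exists2 ys', s w = code_seq ys' & catrev zs ys' = catrev xs ys) _ _ _)).
- by split=> //; exists ys.
- by move=> {sv sw}s [sv _]; rewrite /= sv.
- move=> z zs {sv sw}s [sv [ys' sw eq_c]]; rewrite /= sv; split=> //.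
  steps; split=> //.
  rewrite !eqxx vw eq_sym vw /= sv; split=> //.
  by exists (z :: ys'); rewrite //= sw.
- by move=> t s' _ [tB [s'v [ys' s'w /= <-]]].
Qed.

(** * The branching algorithm *)

(* Variables: 2 holds the family and 3 a stack of pairs (T, b), where T is to be
   extended by at most b points. The top of the stack is unpacked to 5 (T) and
   4 (b), the two members compared are in 6 and 7, their fresh copies in 10 and
   11, and a pair with the same trace, if flag 20 is set, in 18 and 19. *)

Definition Differ : cmd :=
  If (EHd $10) (If (EHd $11) (Assign 12 ENil) (Assign 12 etrue))
    (Assign 12 (EHd $11)).

(** An idle command: it touches only the scratch variable 12. *)
Definition Skip : cmd := Assign 12 ENil.

Lemma wp_Differ s a b x y : s 10 = Cons (code_bool a) x -> s 11 = Cons (code_bool b) y ->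
  wp Differ s (fun t s' => t <= 20 /\ s' 12 = code_bool (a (+) b)).
Proof.
move=> s10 s11; apply: wp_if; rewrite /= s10 truth_code_bool.
case: a {s10} => /=; last by apply: wp_assign; rewrite /= s11; case: b {s11}.
by apply: wp_if; rewrite /= s11 truth_code_bool; case: b {s11}; apply: wp_assign.
Qed.

Definition Separate : cmd :=
  Assign 8 ENil ;; Assign 9 $5 ;; Assign 10 $6 ;; Assign 11 $7 ;;
  While $9 (
    Differ ;; If (EHd $9) (If $12 (Assign 8 etrue) Skip) Skip ;;
    Assign 9 (ETl $9) ;; Assign 10 (ETl $10) ;; Assign 11 (ETl $11)).

Lemma wp_Separate n (T A B : {set 'I_n}) s :
  s 5 = code_set T -> s 6 = code_set A -> s 7 = code_set B ->
  wp Separate s (fun t s' => t <= n * 100 + 100 /\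
    s' 8 = code_bool (A :&: T != B :&: T)).
Proof.
move=> s5 s6 s7; rewrite /Separate; steps.
(* [P i] says that [i] witnesses a difference of the traces. Throughout the scan, the traces differ
   iff the flag is set or a witness lies ahead. *)
pose P i := (i \in T) && ((i \in A) (+) (i \in B)).
apply: (wp_call (wp_foreach (B := 80) (xs := enum 'I_n) (I := fun l s =>
  [/\ s 9 = bits T l, s 10 = bits A l, s 11 = bits B l &
    exists2 b, s 8 = code_bool b & b || has P l = (A :&: T != B :&: T)]) _ _ _)).
- split=> //=; exists false => //=; apply/hasP/idP => [[i _ /andP[iT iAB]]|AB].
    by apply/eqP => /setP/(_ i); rewrite !inE iT !andbT => AB; rewrite AB addbb in iAB.
  have /existsP[i iP] : [exists i, (i \in A :&: T) != (i \in B :&: T)].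
    apply: contraR AB; rewrite negb_exists => /forallP AB; apply/eqP/setP => i.
    by have := AB i; rewrite negbK => /eqP.
  exists i; rewrite ?mem_enum // /P; move: iP; rewrite !inE.
  by case: (i \in A) (i \in B) (i \in T) => [] [] [].
- by move=> s0 [s9 _ _ _]; rewrite /= s9.
- move=> i l s0 [/= s9 s10 s11 [b s8 eqb]]; rewrite s9; split=> //.
  apply: wp_seq; apply: (wp_call (wp_Differ s10 s11)) => t s1 fr [tB s12].
  apply: wp_seq; apply: wp_if; rewrite /= fr // s9 /=.
  rewrite truth_code_bool.
  (* All branches of the conditional end with the same advance along the three rows. *)
  have fin t2 s2 : t2 <= 30 -> s2 9 = s0 9 -> s2 10 = s0 10 -> s2 11 = s0 11 ->
      s2 8 = code_bool (b || P i) ->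
      wp (Assign 9 (ETl $9) ;; Assign 10 (ETl $10) ;; Assign 11 (ETl $11)) s2
       (fun t3 s3 => (t + (t2 + t3).+1).+1 <= 80 /\
    [/\ s3 9 = bits T l, s3 10 = bits A l, s3 11 = bits B l &
    exists2 b, s3 8 = code_bool b & b || has P l = (A :&: T != B :&: T)]).
    move=> t2B e9 e10 e11 e8; steps; split; first by lia.
    rewrite e9 e10 e11 s9 s10 s11; split=> //; exists (b || P i) => //.
    by rewrite -orbA.
  case: ifP => iT.
    apply: wp_if; rewrite /= s12 truth_code_bool.
    case: ifP => h; apply: wp_assign; apply: fin; rewrite //= ?fr //.
      by rewrite /P iT h orbT.
    by rewrite s8 /P iT h orbF.
  by apply: wp_assign; apply: fin; rewrite //= ?fr // s8 /P iT orbF.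
- move=> t s' _ [tB [_ _ _ [b -> <-]]]; split; last by rewrite orbF.
  by move: tB; rewrite size_enum_ord /=; lia.
Qed.

Definition rows n (r : seq {set 'I_n}) : tree :=
  code_seq [seq code_set A | A <- r].

(** Each member is compared only with the later ones. The scan does not stop at a success, so the
    last pair found is the one kept. *)
Definition Find : cmd :=
  Assign 20 ENil ;; Assign 16 $2 ;;
  While $16 (
    Assign 6 (EHd $16) ;; Assign 16 (ETl $16) ;; Assign 17 $16 ;;
    While $17 (
      Assign 7 (EHd $17) ;; Assign 17 (ETl $17) ;; Separate ;;
      If $8 Skip (Assign 20 etrue ;; Assign 18 $6 ;; Assign 19 $7))).

Lemma wp_Find n (T : {set 'I_n}) r s :
  uniq r -> s 5 = code_set T -> s 2 = rows r ->
  wp Find s (fun t s' =>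
    t <= size r * (size r * (n * 100 + 200) + 100) + 100 /\
    exists2 b, s' 20 = code_bool b &
    if b then exists A B, [/\ A \in r, B \in r, A != B, A :&: T = B :&: T &
        s' 18 = code_set A /\ s' 19 = code_set B]
      else pairwise (fun A B => A :&: T != B :&: T) r).
Proof.
move=> uniq_r s5 s2; rewrite /Find; steps.
pose sep A B := A :&: T != B :&: T.
(* [P] says that the pairs still to be compared are separated. As long as the flag is unset, the
   pairs already compared are separated, so [P] yields the claim for all of [r]; at the end [P] is
   vacuous. *)
pose found (P : bool) (s : store) := exists2 b, s 20 = code_bool b &
    if b then exists A B, [/\ A \in r, B \in r, A != B, A :&: T = B :&: T &
        s 18 = code_set A /\ s 19 = code_set B]
      else P -> pairwise sep r.
apply: (wp_call (wp_foreach (B := size r * (n * 100 + 200) + 90) (xs := r)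
  (I := fun xs s => [/\ s 5 = code_set T, s 16 = rows xs, {subset xs <= r},
      uniq xs & found (pairwise sep xs) s]) _ _ _)).
- by split=> //=; exists false.
- by move=> s0 [_ s16 _ _ _]; rewrite /= s16.
- move=> A xs s0 [/= s0_5 s0_16 sub /andP[Axs uniq_xs] fnd].
  rewrite s0_16; split=> //.
  steps; rewrite s0_16 /=.
  apply: (wp_call (wp_foreach (B := n * 100 + 170) (xs := xs)
    (I := fun ys s => [/\ s 5 = code_set T, s 6 = code_set A, s 16 = rows xs,
        s 17 = rows ys & {subset ys <= xs} /\
        found (all (sep A) ys && pairwise sep xs) s]) _ _ _)).
  + by split=> //; split.
  + by move=> s1 [_ _ _ s17 _]; rewrite /= s17.
  + move=> B ys s1 [/= s1_5 s1_6 s1_16 s1_17 [sub' fnd']].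
    rewrite s1_17; split=> //; steps; rewrite s1_17 /=.
    apply: (wp_call (wp_Separate (T := T) (A := A) (B := B) _ _ _)) => //.
    move=> t1 s2' fr [t1B s2_8]; apply: wp_if; rewrite /= s2_8 truth_code_bool.
    have sub2 : {subset ys <= xs} by move=> C Cys; apply: sub'; rewrite inE Cys orbT.
    case: ifP => [dif|/negbFE/eqP same].
      apply: wp_assign; rewrite /=; split; first by lia.
      rewrite !fr //=; split=> //; split=> //.
      case: fnd' => b sb fb; exists b; rewrite /= !fr //.
      by rewrite /sep dif in fb.
    steps; split; first by lia.
    rewrite !fr //=; split=> //; split=> //.
    exists true => //=; exists A, B; split=> //.
    * by apply: sub; rewrite inE eqxx.
    * by apply: sub; rewrite inE sub' ?orbT // inE eqxx.
    * by apply: contraNneq Axs => ->; apply: sub'; rewrite inE eqxx.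
  + move=> t s1 fr [tB [s1_5 _ s1_16 _ [_ fnd']]]; split.
      have : size xs <= size r.
        by apply: uniq_leq_size => // C Cxs; apply: sub; rewrite inE Cxs orbT.
      by move: tB; rewrite /=; nia.
    by split=> // C Cxs; apply: sub; rewrite inE Cxs orbT.
- move=> t s' _ [tB [_ _ _ _ [b s20 fb]]]; split; first by move: tB => /=; nia.
  by exists b => //; case: b fb {s20} => // ->.
Qed.

(** Variable 13 keeps the visited prefix of the row of T in reverse. The row of a child is the
    unread tail with its first bit replaced by true, and the prefix reversed back onto it. *)
Definition Push : cmd :=
  Assign 9 $5 ;; Assign 10 $6 ;; Assign 11 $7 ;; Assign 13 ENil ;;
  While $9 (
    Differ ;;
    If $12
      (Assign 14 (ECons etrue (ETl $9)) ;; Assign 15 $13 ;; CatRev 15 14 ;;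
       Assign 3 (ECons (ECons $14 (ETl $4)) $3))
      Skip ;;
    Assign 13 (ECons (EHd $9) $13) ;;
    Assign 9 (ETl $9) ;; Assign 10 (ETl $10) ;; Assign 11 (ETl $11)).

Definition stack n (st : seq ({set 'I_n} * nat)) : tree :=
  code_seq [seq Cons (code_set p.1) (code_nat p.2) | p <- st].

Lemma wp_Push n (T A B : {set 'I_n}) b st s :
  s 3 = stack st -> s 4 = code_nat b.+1 ->
  s 5 = code_set T -> s 6 = code_set A -> s 7 = code_set B ->
  wp Push s (fun t s' => t <= n * (n * 20 + 100) + 100 /\
    s' 3 = stack (catrev
      [seq (i |: T, b) | i <- enum 'I_n & (i \in A) (+) (i \in B)] st)).
Proof.
move=> s3 s4 s5 s6 s7; rewrite /Push; steps.
pose P i := (i \in A) (+) (i \in B).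
pose new l := [seq (i |: T, b) | i <- l & P i].
apply: (wp_call (wp_foreach (B := n * 20 + 90) (xs := enum 'I_n) (I := fun l s =>
  [/\ s 9 = bits T l, s 10 = bits A l, s 11 = bits B l, s 4 = code_nat b.+1 &
   exists2 k, k ++ l = enum 'I_n &
   s 13 = bits T (rev k) /\ s 3 = stack (catrev (new k) st)]) _ _ _)).
- by split=> //; exists [::].
- by move=> s0 [s9 _ _ _ _]; rewrite /= s9.
- move=> i l s0 [/= s9 s10 s11 s0_4 [k kl [s13 s0_3]]]; rewrite s9; split=> //.
  apply: wp_seq; apply: (wp_call (wp_Differ s10 s11)) => t s1 fr [tB s12].
  apply: wp_seq; apply: wp_if; rewrite /= s12 truth_code_bool.
  have fin t2 s2 : t2 <= n * 20 + 50 -> s2 9 = s0 9 -> s2 10 = s0 10 ->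
      s2 11 = s0 11 -> s2 4 = s0 4 -> s2 13 = s0 13 ->
      s2 3 = stack (catrev (new (rcons k i)) st) ->
      wp (Assign 13 (ECons (EHd $9) $13) ;; Assign 9 (ETl $9) ;;
          Assign 10 (ETl $10) ;; Assign 11 (ETl $11)) s2
       (fun t3 s3 => (t + (t2 + t3).+1).+1 <= n * 20 + 90 /\
  [/\ s3 9 = bits T l, s3 10 = bits A l, s3 11 = bits B l, s3 4 = code_nat b.+1 &
   exists2 k, k ++ l = enum 'I_n &
   s3 13 = bits T (rev k) /\ s3 3 = stack (catrev (new k) st)]).
    move=> t2B e9 e10 e11 e4 e13 e3; steps; split; first by lia.
    rewrite e9 e10 e11 e4 e13 s9 s10 s11 s13; split=> //.
    exists (rcons k i); first by rewrite cat_rcons.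
    by rewrite rev_rcons e3.
  have new_rcons : new (rcons k i) = if P i then rcons (new k) (i |: T, b) else new k.
    by rewrite /new filter_rcons; case: (P i) => //; rewrite map_rcons.
  rewrite -/(P i); case: ifP => iP; last first.
    by apply: wp_assign; apply: fin; rewrite /= ?fr // ?new_rcons ?iP //; lia.
  apply: wp_seq; apply: wp_assign; apply: wp_seq; apply: wp_assign; apply: wp_seq.
  rewrite /= !fr // s9 s13 /=.
  apply: (wp_call (wp_CatRev (v := 15) (w := 14)
    (xs := [seq code_bool (i \in T) | i <- rev k])
    (ys := code_bool true :: [seq code_bool (i \in T) | i <- l]) _ _ _)) => //.
  move=> t2 s2 fr2 [t2B _ s2_14].
  have kB : size k <= n.
    by rewrite -[X in _ <= X]size_enum_ord -kl size_cat leq_addr.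
  have {}t2B : t2 <= n * 11 + 2.
    by apply: leq_trans t2B _; rewrite size_map size_rev leq_add2r leq_mul2r kB orbT.
  (* The point [i] occurs only once in the enumeration, so the bits before and after it are those of
     [T]. *)
  have kl_uniq : uniq (k ++ i :: l) by rewrite kl enum_uniq.
  have eq14 : s2 14 = code_set (i |: T).
    rewrite s2_14 catrevE -map_rev revK /code_set -kl map_cat /= !inE eqxx.
    move: kl_uniq; rewrite cat_uniq /= negb_or -andbA => /and5P[_ ik _ il _].
    congr (code_seq (_ ++ _ :: _)); apply/eq_in_map => j jl; rewrite !inE.
      by case: eqP => // ji; rewrite -ji jl in ik.
    by case: eqP => // ji; rewrite -ji jl in il.
  apply: wp_assign; apply: fin; first by rewrite /=; lia.
  1-5: by rewrite /= fr2 //= fr.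
  rewrite /= eq14 !fr2 //= !fr //= s0_4 s0_3 new_rcons iP /stack.
  by rewrite !catrevE rev_rcons.
- move=> t s' _ [tB [_ _ _ _ [k]]]; rewrite cats0 => -> [_ ->]; split=> //.
  by move: tB; rewrite size_enum_ord /=; lia.
Qed.

(** * The search tree: correctness, size and traversal *)

Lemma pairwise_tracking n (F : {set {set 'I_n}}) r T : r =i F ->
  pairwise (fun A B => A :&: T != B :&: T) r -> tracking F T.
Proof.
move=> rF /(pairwiseP set0) sep A B; rewrite -!rF => Ar Br AB ABT.
have [iA iB] : index A r < size r /\ index B r < size r by rewrite !index_mem.
have [lt|gt|eq] := ltngtP (index A r) (index B r).
- by have := sep _ _ iA iB lt; rewrite !nth_index // ABT eqxx.
- by have := sep _ _ iB iA gt; rewrite !nth_index // ABT eqxx.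
- by apply: AB; rewrite -(nth_index set0 Ar) eq nth_index.
Qed.

Definition extensible n (F : {set {set 'I_n}}) (T : {set 'I_n}) (b : nat) : Prop :=
  exists2 U : {set 'I_n}, #|U| <= b & tracking F (T :|: U).

Lemma tracking_extensible n (F : {set {set 'I_n}}) T b :
  tracking F T -> extensible F T b.
Proof. by exists set0; rewrite ?cards0 ?setU0. Qed.

(** If [T :|: U] separates [A] and [B] while [T] does not, then [U] contains a point of their
    symmetric difference; moving it from [U] to [T] uses up one unit of budget. Conversely, the
    point can be moved back. *)
Lemma extensible_branch n (F : {set {set 'I_n}}) b (T A B : {set 'I_n}) :
    A \in F -> B \in F -> A != B -> A :&: T = B :&: T ->
  extensible F T b <-> 0 < b /\
    exists2 i, (i \in A) (+) (i \in B) & extensible F (i |: T) b.-1.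
Proof.
move=> AF BF /eqP AB ABT; split=> [[U Ub tr]|[b0 [i _ [U Ub tr]]]]; last first.
  exists (i |: U); last by rewrite setUCA setUA.
  by rewrite cardsU1; move: Ub; case: (_ \notin _); lia.
have /existsP[i /andP[iU iAB]] : [exists i, (i \in U) && ((i \in A) (+) (i \in B))].
  apply/negbNE; rewrite negb_exists; apply/negP => /forallP same.
  apply: (tr A B AF BF AB); rewrite !setIUr ABT; congr (_ :|: _).
  apply/setP => i; rewrite !inE; have := same i; case: (i \in U) => /=.
    by rewrite negb_add => /eqP ->.
  by rewrite !andbF.
split; first by apply: leq_trans Ub; apply/card_gt0P; exists i.
exists i => //; exists (U :\ i).
  by move: Ub; rewrite (cardsD1 i) iU; lia.
by rewrite -setUA setUCA setD1K.
Qed.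

(** The number of nodes of the complete [c]-ary tree of depth [b]. *)
Fixpoint nodes (c b : nat) : nat :=
  if b is b'.+1 then (c * nodes c b').+1 else 1.

Lemma nodes_gt0 c b : 0 < nodes c b. Proof. by case: b. Qed.

(** Each of the [b.+1] levels has at most [c ^ b] nodes. *)
Lemma nodes_leq c b : 0 < c -> nodes c b <= b.+1 * c ^ b.
Proof.
move=> c0; elim: b => // b IH; rewrite /= expnS.
have cb : 0 < c * c ^ b by rewrite muln_gt0 c0 expn_gt0 c0.
have : c * nodes c b <= c * (b.+1 * c ^ b) by rewrite leq_mul.
by rewrite mulnCA [b.+2 * _]mulSn; lia.
Qed.

(** The search starts from the empty set, whose row is literally the unary code of the ground set. A
    success clears the stack, which ends the loop. *)
Definition Branching : cmd :=
  Assign 3 (ECons (ECons (EHd $0) (ETl (ETl $0))) ENil) ;;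
  Assign 2 (EHd (ETl $0)) ;; Assign 0 ENil ;;
  While $3 (
    Assign 5 (EHd (EHd $3)) ;; Assign 4 (ETl (EHd $3)) ;; Assign 3 (ETl $3) ;;
    Find ;;
    If $20
      (If $4 (Assign 6 $18 ;; Assign 7 $19 ;; Push) Skip)
      (Assign 0 etrue ;; Assign 3 ENil)).

Lemma code_nat_set0 n : code_nat n = code_set (set0 : {set 'I_n}).
Proof.
rewrite /code_nat /code_set; congr code_seq; rewrite -[in LHS](size_enum_ord n).
by elim: (enum _) => //= i l ->; rewrite inE.
Qed.

Lemma size_sym_diff n (A B : {set 'I_n}) d : #|A| <= d -> #|B| <= d ->
  size [seq i <- enum 'I_n | (i \in A) (+) (i \in B)] <= 2 * d.
Proof.
move=> Ad Bd; apply: (@leq_trans (size (enum A ++ enum B))).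
  apply: uniq_leq_size; first by rewrite filter_uniq ?enum_uniq.
  by move=> i; rewrite mem_filter mem_cat !mem_enum => /andP[]; case: (i \in A).
by rewrite size_cat -!cardE; lia.
Qed.

(** One call of [Find], one of [Push], and a constant for the rest of the round. *)
Definition branching_step n m : nat :=
  m * (m * (n * 100 + 200) + 100) + 100 + (n * (n * 20 + 100) + 100) + 100.

Lemma wp_Branching d n (F : {set {set 'I_n}}) r k s :
    uniq r -> r =i F -> (forall A, A \in F -> #|A| <= d) ->
    s 0 = Cons (code_nat n) (Cons (rows r) (code_nat k)) ->
  wp Branching s (fun t s' =>
    t <= nodes (2 * d) k * (branching_step n (size r) + 2) + 50 /\
    exists2 b, s' 0 = code_bool b &
      (exists2 T, tracking F T & #|T| <= k) <-> b).
Proof.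
move=> r_uniq rF Fd s0; rewrite /Branching; steps; rewrite s0 /=.
set B := branching_step _ _; set yes := exists2 _, _ & _.
(* The measure of the loop: the total size of the full search trees below the stacked pairs. The
   invariant adds that the instance is a yes-instance iff the answer is already set or some stacked
   pair is extensible. *)
pose weight (st : seq ({set 'I_n} * nat)) := sumn [seq nodes (2 * d) p.2 | p <- st].
have weight_catrev st st' : weight (catrev st st') = weight st + weight st'.
  by rewrite /weight catrevE map_cat sumn_cat map_rev sumn_rev.
pose Inv m s := exists st ans, [/\ s 3 = stack st, s 2 = rows r,
  s 0 = code_bool ans, m = weight st &
  yes <-> ans \/ exists2 p, p \in st & extensible F p.1 p.2].
apply: (wp_call (wp_while (I := Inv) (B := B)
   (m := weight [:: (set0, k)]) _ _)).
- exists [:: (set0, k)], false; split=> //=.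
    by rewrite /stack /= code_nat_set0.
  split=> [[T trT Tk]|[//|[p]]].
    by right; exists (set0, k); rewrite ?inE //; exists T; rewrite ?set0U.
  by rewrite inE => /eqP -> [U Uk tr]; exists U => //; rewrite set0U in tr.
- move=> {s s0} m s [st [ans [s3 s2 s0 -> inv]]] /=.
  case: st s3 inv => [|[T b] st] s3 inv; first by rewrite s3.
  move=> _; steps; rewrite s3 /=.
  apply: (wp_call (wp_Find (T := T) (r := r) _ _ _)) => //= t1 s1 fr.
  move=> [t1B [fnd s1_20 fndP]].
  apply: wp_if; rewrite /= s1_20 truth_code_bool; case: fnd fndP {s1_20}; last first.
    move=> /(pairwise_tracking rF) trT; steps; split.
      by rewrite /B /branching_step; lia.
    (* The cleared stack has weight 0; the old weight was positive, as the popped pair counts at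
       least its own root. *)
    exists 0 => //; first by rewrite addn_gt0 nodes_gt0.
    exists [::], true; split; rewrite //= ?fr //; split; first by left.
    move=> _; apply/inv; right; exists (T, b); first by rewrite inE eqxx.
    exact: tracking_extensible.
  move=> [C [D [Cr Dr CD CDT [s1_18 s1_19]]]].
  rewrite rF in Cr; rewrite rF in Dr.
  have br := extensible_branch b Cr Dr CD CDT.
  (* With no budget left, [br] shows the popped pair to be a dead end, and it is dropped. *)
  apply: wp_if; rewrite /= fr //=; case: b s3 inv br fr => [|b] s3 inv br fr /=.
    apply: wp_assign; rewrite /=; split; first by rewrite /B /branching_step; lia.
    exists (weight st) => //.
    exists st, ans; split; rewrite //= ?fr //.
    split.
      move=> /inv[->|[p]]; first by left.
      rewrite inE => /orP[/eqP -> /br[]//|pst ext]; by right; exists p.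
    move=> [ans1|[p pst ext]]; apply/inv; first by left.
    by right; exists p => //; rewrite inE pst orbT.
  steps; rewrite s1_18 s1_19.
  apply: (wp_call (wp_Push (T := T) (A := C) (B := D) (b := b) (st := st)
    _ _ _ _ _)); rewrite //= ?fr //=.
  move=> t2 s2' fr2 [t2B s2_3]; split; first by rewrite /B /branching_step; lia.
  eexists; last first.
    exists (catrev [seq (i |: T, b) | i <- enum 'I_n & (i \in C) (+) (i \in D)] st), ans.
    split=> //; rewrite ?fr2 //= ?fr //.
    split.
      move=> /inv[->|[p]]; first by left.
      rewrite inE => /orP[/eqP -> /br[_ [i iCD ext]]|pst ext]; right.
        exists (i |: T, b) => //; rewrite catrevE mem_cat mem_rev; apply/orP; left.
        by apply/mapP; exists i; rewrite // mem_filter iCD mem_enum.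
      by exists p => //; rewrite catrevE mem_cat pst orbT.
    move=> [ans1|[p]]; first by apply/inv; left.
    rewrite catrevE mem_cat mem_rev => /orP[/mapP[i iCD ->]|pst] ext;
      apply/inv; right.
      exists (T, b.+1); first by rewrite inE eqxx.
      by apply/br; split=> //; exists i => //; move: iCD; rewrite mem_filter => /andP[].
    by exists p => //; rewrite inE pst orbT.
  have weight_const l :
      weight [seq (i |: T, b) | i <- l] = size l * nodes (2 * d) b.
    by rewrite /weight; elim: l => // i l IH; rewrite 2!map_cons [LHS]/= -/sumn IH mulSn.
  (* A node of budget [b.+1] is replaced by at most [2 * d] nodes of budget [b]; the root accounts
     for the strict decrease. *)
  rewrite weight_catrev weight_const /weight /= ltn_add2r ltnS leq_mul2r.
  by rewrite size_sym_diff ?orbT ?Fd.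
- move=> t s' _ [tB fa [m [st [ans [s3 _ s0' _ inv]]]]]; split.
    by move: tB; rewrite /weight /= addn0; lia.
  exists ans => //; case: st s3 inv => [|p st] s3 inv; last by rewrite /= s3 in fa.
  by rewrite inv; split=> [[//|[p]]|]; [rewrite in_nil | left].
Qed.

(** * The kernelization *)

(* Variables: 1, 2 and 3 hold the ground set, the family and the budget, 5 the
   number (k+1)^d in unary, and 6 the union of the family. The result is built
   in 14 (ground set) and 11 (family). *)

Definition Product : cmd :=
  Assign 6 (ECons ENil $3) ;; Assign 7 ENil ;;
  While $6 (Assign 6 (ETl $6) ;; Assign 8 $5 ;; CatRev 8 7) ;;
  Assign 5 $7.

Lemma wp_Product a k s : s 5 = code_nat a -> s 3 = code_nat k ->
  wp Product s (fun t s' => t <= k.+1 * (a * 11 + 20) + 20 /\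
    s' 5 = code_nat (a * k.+1)).
Proof.
move=> s5 s3; rewrite /Product; steps.
(* The loop runs over the unary budget with one cell added, which gives the factor [k.+1]. *)
apply: (wp_call (wp_foreach (B := a * 11 + 15) (xs := nseq k.+1 Defs.Nil)
  (I := fun l s => [/\ s 6 = code_seq l, s 5 = code_nat a &
     exists2 b, s 7 = code_nat b & b + a * size l = a * k.+1]) _ _ _)).
- rewrite /= s3; split=> //; exists 0 => //; by rewrite size_nseq.
- by move=> s0 [s6 _ _]; rewrite /= s6.
- move=> x l s0 [/= s6 s0_5 [b s7 eqb]]; rewrite s6; split=> //; steps.
  apply: (wp_call (wp_CatRev (v := 8) (w := 7) (xs := nseq a Defs.Nil)
     (ys := nseq b Defs.Nil) _ _ _)) => //= t s1 fr [tB _ s1_7].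
  rewrite size_nseq in tB; split; first by lia.
  rewrite (fr 6) // (fr 5) //= s6; split=> //; exists (a + b); last by rewrite -eqb; nia.
  rewrite s1_7 catrevE; congr code_seq.
  by rewrite nseqD; congr (_ ++ _);
  elim: (a) => // c IH; rewrite -{1}addn1 nseqD rev_cat IH.
- move=> t s1 _ [tB [_ _ [b s7 eqb]]]; steps; rewrite s7.
  move: tB; rewrite size_nseq => tB; split; first by move: tB => /=; lia.
  by rewrite -eqb muln0 addn0.
Qed.

(** Since [d] is a constant of the problem, the power is unrolled into a chain of [d]
    multiplications. *)
Fixpoint Power (d : nat) : cmd :=
  if d is d'.+1 then Power d' ;; Product else Assign 5 etrue.

(** The frame is stated explicitly because [writes (Power d)] does not compute for a variable
    [d]. *)
Lemma wp_Power d k s : s 3 = code_nat k ->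
  wp (Power d) s (fun t s' =>
    [/\ t <= d * (k.+1 * (k.+1 ^ d * 11 + 20) + 30) + 5,
        s' 5 = code_nat (k.+1 ^ d) &
        forall v, v \notin [:: 5; 6; 7; 8] -> s' v = s v]).
Proof.
move=> s3; elim: d => [|d IH].
  by apply: wp_assign; split=> //= v; rewrite inE => /norP[/negPf ->].
rewrite /=; steps; apply: (wp_call IH) => t s1 _ [tB s1_5 fr].
have s1_3 : s1 3 = code_nat k by rewrite fr.
apply: (wp_call (wp_Product s1_5 s1_3)).
move=> t2 s2 fr2 [t2B s2_5]; split; last 2 first.
- by rewrite s2_5 expnSr.
- by move=> v vw; rewrite fr2 ?fr //; move: vw; rewrite !inE; do 4 case: (v == _).
have le : k.+1 ^ d <= k.+1 ^ d.+1 by rewrite leq_pexp2l.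
have le2 : k.+1 * (k.+1 ^ d * 11 + 20) <= k.+1 * (k.+1 ^ d.+1 * 11 + 20).
  by rewrite leq_mul2l leq_add2r leq_mul2r le orbT.
have le3 : d * (k.+1 * (k.+1 ^ d * 11 + 20) + 30) <= d * (k.+1 * (k.+1 ^ d.+1 * 11 + 20) + 30).
  by rewrite leq_mul2l leq_add2r le2 orbT.
rewrite mulSn; lia.
Qed.

(** Truncated subtraction: the tail of an empty list is empty, so a cell survives in 4 iff the
    family has more members than the number in 5. *)
Definition Overflow : cmd :=
  Assign 4 $2 ;; While $5 (Assign 5 (ETl $5) ;; Assign 4 (ETl $4)).

Lemma wp_Overflow a xs s : s 5 = code_nat a -> s 2 = code_seq xs ->
  wp Overflow s (fun t s' => t <= a * 20 + 20 /\ truth (s' 4) = (a < size xs)).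
Proof.
move=> s5 s2; rewrite /Overflow; steps.
apply: (wp_call (wp_foreach (B := 10) (xs := nseq a Defs.Nil)
  (I := fun l s => s 5 = code_seq l /\ exists2 ys, s 4 = code_seq ys &
     (size l < size ys) = (a < size xs)) _ _ _)).
- by split=> //; exists xs; rewrite // size_nseq.
- by move=> s0 [s5' _]; rewrite /= s5'.
- move=> x l s0 [/= s0_5 [ys s4 eqb]]; rewrite s0_5; split=> //; steps.
  split=> //; rewrite s0_5 s4; split=> //; exists (behead ys); first by case: (ys).
  by rewrite -eqb size_behead; case: (size ys).
- move=> t s1 _ [tB [_ [ys -> eqb]]]; rewrite size_nseq in tB.
  by split; [move: tB => /=; lia | rewrite -eqb; case: (ys)].
Qed.

(** The union starts as the unary ground set, read as the row of the empty set. Each pass reverses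
    it into 9, and [CatRev] restores the order. *)
Definition Union : cmd :=
  Assign 6 $1 ;; Assign 7 $2 ;;
  While $7 (
    Assign 8 (EHd $7) ;; Assign 7 (ETl $7) ;; Assign 9 ENil ;;
    While $6 (
      If (EHd $6) (Assign 10 etrue) (Assign 10 (EHd $8)) ;;
      Assign 9 (ECons $10 $9) ;; Assign 6 (ETl $6) ;; Assign 8 (ETl $8)) ;;
    CatRev 9 6).

Lemma wp_Union n (r : seq {set 'I_n}) s : s 1 = code_nat n -> s 2 = rows r ->
  wp Union s (fun t s' => t <= size r * (n * 50 + 50) + 20 /\
    s' 6 = code_set (\bigcup_(A <- r) A)).
Proof.
move=> s1 s2; rewrite /Union; steps.
apply: (wp_call (wp_foreach (B := n * 50 + 40) (xs := r)
  (I := fun l s => s 7 = rows l /\ exists2 U, s 6 = code_set U &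
     U :|: \bigcup_(A <- l) A = \bigcup_(A <- r) A) _ _ _)).
- by split=> //; exists set0; rewrite ?set0U //= s1 code_nat_set0.
- by move=> s0 [s7 _]; rewrite /= s7.
- move=> A l s0 [/= s7 [U s6 eqU]]; rewrite s7; split=> //; steps; rewrite s7 /=.
  apply: (wp_call (wp_foreach (B := 30) (xs := enum 'I_n)
    (I := fun js s => [/\ s 6 = bits U js, s 8 = bits A js &
       exists2 k, s 9 = bits (U :|: A) (rev k) & k ++ js = enum 'I_n]) _ _ _)).
  + by split=> //; exists [::].
  + by move=> s3 [s6' _ _]; rewrite /= s6'.
  + move=> i js s3 [/= s3_6 s3_8 [k s3_9 kjs]]; rewrite s3_6; split=> //.
    apply: wp_seq; apply: wp_if; rewrite /= s3_6 /= truth_code_bool.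
    rewrite [if _ then _ else _](_ : _ =
      Assign 10 (if i \in U then etrue else EHd $8)); last by case: ifP.
    steps; split; first by case: ifP.
    rewrite s3_6 s3_8 s3_9; split=> //; exists (rcons k i); last by rewrite cat_rcons.
    by rewrite rev_rcons /bits /= inE; case: ifP; rewrite //= s3_8.
  + move=> t s3 fr [tB [s3_6 _ [k s3_9]]]; rewrite cats0 => k_enum.
    rewrite {}k_enum in s3_9.
    apply: (wp_call (wp_CatRev (v := 9) (w := 6) (ys := [::]) _ s3_9 s3_6)) => //.
    move=> t2 s4 fr2 [t2B _ s4_6]; rewrite size_map size_rev size_enum_ord in t2B.
    split; first by move: tB; rewrite size_enum_ord /=; lia.
    split; first by rewrite fr2 // fr.
    exists (U :|: A); last by rewrite -eqU big_cons setUA.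
    by rewrite s4_6 catrevE cats0 -map_rev revK.
- move=> t s' _ [tB [_ [U s6 eqU]]]; split; first by move: tB => /=; lia.
  by rewrite s6 -eqU big_nil setU0.
Qed.

Definition Restrict : cmd :=
  Assign 7 $2 ;; Assign 11 ENil ;;
  While $7 (
    Assign 8 (EHd $7) ;; Assign 7 (ETl $7) ;; Assign 9 ENil ;; Assign 10 $6 ;;
    While $10 (
      If (EHd $10) (Assign 9 (ECons (EHd $8) $9)) Skip ;;
      Assign 10 (ETl $10) ;; Assign 8 (ETl $8)) ;;
    Assign 11 (ECons $9 $11)).

(** Reversed because [Restrict] builds its rows by consing. Undoing this would gain nothing: the new
    points may be numbered in any order. *)
Definition points_in n (U : {set 'I_n}) : seq 'I_n :=
  rev [seq i <- enum 'I_n | i \in U].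

Lemma wp_Restrict n (r : seq {set 'I_n}) U s : s 2 = rows r -> s 6 = code_set U ->
  wp Restrict s (fun t s' => t <= size r * (n * 40 + 50) + 20 /\
    s' 11 = code_seq [seq bits A (points_in U) | A <- rev r]).
Proof.
move=> s2 s6; rewrite /Restrict; steps.
apply: (wp_call (wp_foreach (B := n * 40 + 40) (xs := r)
  (I := fun l s => [/\ s 7 = rows l, s 6 = code_set U & exists2 k, k ++ l = r &
     s 11 = code_seq [seq bits A (points_in U) | A <- rev k]]) _ _ _)).
- by split=> //; exists [::].
- by move=> s0 [s7 _]; rewrite /= s7.
- move=> A l s0 [/= s7 s0_6 [k kl s11]]; rewrite s7; split=> //; steps; rewrite s7 /=.
  apply: (wp_call (wp_foreach (B := 30) (xs := enum 'I_n)
    (I := fun js s => [/\ s 10 = bits U js, s 8 = bits A js &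
       exists2 m, s 9 = bits A (rev [seq i <- m | i \in U]) & m ++ js = enum 'I_n]) _ _ _)).
  + by split=> //; exists [::].
  + by move=> s3 [s10 _ _]; rewrite /= s10.
  + move=> i js s3 [/= s3_10 s3_8 [m s3_9 mjs]]; rewrite s3_10; split=> //.
    apply: wp_seq; apply: wp_if; rewrite /= s3_10 /= truth_code_bool.
    case: ifP => iU; apply: wp_assign; steps; split=> //;
      rewrite s3_10 s3_8 s3_9; split=> //; exists (rcons m i); rewrite ?cat_rcons //;
      by rewrite filter_rcons iU ?rev_rcons.
  + move=> t s3 fr [tB [_ _ [m s3_9]]]; rewrite cats0 => m_enum; subst m.
    steps; split; first by move: tB; rewrite size_enum_ord /=; lia.
    rewrite (fr 7) // (fr 6) // (fr 11) //=; split=> //.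
    exists (rcons k A); first by rewrite cat_rcons.
    by rewrite rev_rcons /= s3_9 s11.
- move=> t s' _ [tB [_ _ [k]]]; rewrite cats0 => -> ->; split=> //.
  by move: tB => /=; lia.
Qed.

Definition Count : cmd :=
  Assign 14 ENil ;;
  While $6 (If (EHd $6) (Assign 14 (ECons ENil $14)) Skip ;; Assign 6 (ETl $6)).

Lemma wp_Count n (U : {set 'I_n}) s : s 6 = code_set U ->
  wp Count s (fun t s' => t <= n * 30 + 20 /\ s' 14 = code_nat (size (points_in U))).
Proof.
move=> s6; rewrite /Count; steps.
apply: (wp_call (wp_foreach (B := 20) (xs := enum 'I_n)
  (I := fun l s => s 6 = bits U l /\ exists2 k, s 14 = code_nat k &
     k + size [seq i <- l | i \in U] = size (points_in U)) _ _ _)).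
- by split=> //; exists 0; rewrite // size_rev.
- by move=> s0 [s6' _]; rewrite /= s6'.
- move=> i l s0 [/= s0_6 [k s14 eqk]]; rewrite s0_6; split=> //.
  apply: wp_seq; apply: wp_if; rewrite /= s0_6 /= truth_code_bool.
  case: ifP eqk => iU eqk; apply: wp_assign; steps; split=> //; rewrite s0_6; split=> //.
    by exists k.+1; [rewrite s14 | rewrite -eqk /= addnS].
  by exists k.
- move=> t s' _ [tB [_ [k -> <-]]]; rewrite addn0; split=> //.
  by move: tB; rewrite size_enum_ord /=; lia.
Qed.

Definition Kernel (d : nat) : cmd :=
  Assign 1 (EHd $0) ;; Assign 2 (EHd (ETl $0)) ;; Assign 3 (ETl (ETl $0)) ;;
  Power d ;; Overflow ;;
  If $4
    (Assign 0 (ECons etrue (ECons (ECons (ECons ENil ENil)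
       (ECons (ECons etrue ENil) ENil)) ENil)))
    (Union ;; Restrict ;; Count ;; Assign 0 (ECons $14 (ECons $11 $3))).

(** In order: [Power], [Overflow], then [Union] and [Restrict] together, [Count], and a constant. *)
Definition kernel_time d n m k : nat :=
  d * (k.+1 * (k.+1 ^ d * 11 + 20) + 30) + (k.+1 ^ d * 20) +
  m * (n * 90 + 100) + n * 30 + 200.

Lemma wp_Kernel d n (r : seq {set 'I_n}) k s :
    s 0 = Cons (code_nat n) (Cons (rows r) (code_nat k)) ->
  let us := points_in (\bigcup_(A <- r) A) in
  wp (Kernel d) s (fun t s' => t <= kernel_time d n (size r) k /\
    s' 0 = if k.+1 ^ d < size r
           then Cons (code_nat 1) (Cons (rows [:: set0; [set: 'I_1]]) Nil)
           else Cons (code_nat (size us))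
             (Cons (code_seq [seq bits A us | A <- rev r]) (code_nat k))).
Proof.
move=> s0 us; rewrite /Kernel; steps; rewrite s0 /=.
apply: (wp_call (wp_Power (k := k) _ _)) => //= t1 s1 _ [t1B s1_5 fr1].
apply: wp_seq; apply: (wp_call (wp_Overflow (xs := [seq code_set A | A <- r]) s1_5 _)).
  by rewrite fr1.
rewrite size_map => t2 s2 fr2 [t2B s2_4]; apply: wp_if; rewrite /= s2_4.
case: ifP => big.
  apply: wp_assign; rewrite /=; split; first by rewrite /kernel_time; lia.
  by rewrite /rows /= /code_set !enum_ordSl enum_ord0 /= !inE.
apply: wp_seq; apply: (wp_call (wp_Union (r := r) _ _)); rewrite ?fr2 ?fr1 //.
move=> t3 s3 fr3 [t3B s3_6].
apply: wp_seq; apply: (wp_call (wp_Restrict (r := r) _ s3_6)); rewrite ?fr3 ?fr2 ?fr1 //.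
move=> t4 s4 fr4 [t4B s4_11].
apply: wp_seq; apply: (wp_call (wp_Count (U := \bigcup_(A <- r) A) _)); rewrite ?fr4 //.
move=> t5 s5 fr5 [t5B s5_14]; apply: wp_assign; rewrite /=; split.
  by rewrite /kernel_time; lia.
by rewrite s5_14 fr5 // s4_11 fr5 // fr4 // fr3 // fr2 // fr1.
Qed.

(** * Counting traces and shrinking the ground set *)

Lemma card_small_subsets (X : finType) (T : {set X}) d :
  #|[set B : {set X} | B \subset T & #|B| <= d]| <= #|T|.+1 ^ d.
Proof.
elim: d => [|d IH].
  rewrite expn0 -(cards1 (set0 : {set X})); apply: subset_leq_card.
  by apply/subsetP => B; rewrite !inE leqn0 cards_eq0 => /andP[].
(* With t the size of [T], the subsets of size exactly [d.+1] number at most t^(d+1), hence at most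
   t(t+1)^d; the smaller ones number at most (t+1)^d by induction. The sum is (t+1)^(d+1). *)
have sub : [set B : {set X} | B \subset T & #|B| <= d.+1] \subset
    [set B : {set X} | B \subset T & #|B| <= d] :|:
    [set B : {set X} | B \subset T & #|B| == d.+1].
  by apply/subsetP => B; rewrite !inE leq_eqVlt ltnS;
    case: (B \subset T) => //=; rewrite orbC.
apply: leq_trans (subset_leq_card sub) _; apply: leq_trans (leq_card_setU _ _) _.
rewrite cards_draws expnS mulSn leq_add //.
apply: (@leq_trans (#|T| ^ d.+1)).
  apply: (@leq_trans (#|T| ^_ d.+1)); first by rewrite -bin_ffact leq_pmulr ?fact_gt0.
  by elim: d.+1 => // e IHe; rewrite ffactnSr expnSr leq_mul ?leq_subr.
rewrite expnS leq_mul2l; apply/orP; right.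
by case: (d) => // e; rewrite leq_exp2r.
Qed.

Lemma tracking_card_leq n (F : {set {set 'I_n}}) T d k :
    tracking F T -> #|T| <= k -> (forall A, A \in F -> #|A| <= d) ->
  #|F| <= k.+1 ^ d.
Proof.
move=> trT Tk Fd; have inj : {in F &, injective (fun A => A :&: T)}.
  by move=> A B AF BF ABT; apply/eqP/negPn/negP => /eqP AB; apply: (trT A B).
rewrite -(card_in_imset inj).
apply: (@leq_trans (#|T|.+1 ^ d)); last by case: (d) => // e; rewrite leq_exp2r.
apply: leq_trans (card_small_subsets T d); apply: subset_leq_card.
apply/subsetP => _ /imsetP[A AF ->]; rewrite inE subsetIr /=.
exact: leq_trans (subset_leq_card (subsetIl _ _)) (Fd A AF).
Qed.

(** Renumbers the points: [j] stands for the entry of [us] at position [j]. *)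
Definition restriction n (us : seq 'I_n) (A : {set 'I_n}) : {set 'I_(size us)} :=
  [set j | tnth (in_tuple us) j \in A].

Lemma code_set_restriction n (us : seq 'I_n) A :
  code_set (restriction us A) = bits A us.
Proof.
congr code_seq; have <- := congr1 (map (fun i => code_bool (i \in A)))
  (map_tnth_enum (in_tuple us)).
by rewrite -[RHS]map_comp; apply: eq_map => j; rewrite /= inE.
Qed.

Lemma restrictionI n (us : seq 'I_n) A B :
  restriction us (A :&: B) = restriction us A :&: restriction us B.
Proof. by apply/setP => j; rewrite !inE. Qed.

Lemma restriction_inj n (us : seq 'I_n) (A B : {set 'I_n}) :
    {subset A <= us} -> {subset B <= us} ->
  restriction us A = restriction us B -> A = B.
Proof.
move=> Aus Bus AB; apply/setP => i.
have [ius|ius] := boolP (i \in us); last first.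
  by rewrite (contraNF (Aus i) ius) (contraNF (Bus i) ius).
have /tnthP[j ->] : i \in in_tuple us by [].
by move/setP: AB => /(_ j); rewrite !inE.
Qed.

Lemma card_restriction n (us : seq 'I_n) A : uniq us -> #|restriction us A| <= #|A|.
Proof.
move=> us_uniq; have /tuple_uniqP inj : uniq (in_tuple us) by [].
rewrite -(card_imset _ inj).
by apply: subset_leq_card; apply/subsetP => _ /imsetP[j + ->]; rewrite inE.
Qed.

Lemma tracking_restriction n (F : {set {set 'I_n}}) us k : uniq us ->
    (forall A, A \in F -> {subset A <= us}) ->
  (exists2 T, tracking F T & #|T| <= k) <->
  (exists2 T, tracking [set restriction us A | A in F] T & #|T| <= k).
Proof.
move=> us_uniq Fus; split=> [[T trT Tk]|[T trT Tk]].
  exists (restriction us T); last exact: leq_trans (card_restriction _ _) Tk.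
  move=> _ _ /imsetP[A AF ->] /imsetP[B BF ->] AB; rewrite -!restrictionI => eq_r.
  apply: (trT A B) => // [eqAB|]; first by apply: AB; rewrite eqAB.
  apply: restriction_inj eq_r => i; rewrite inE => /andP[iA _].
    exact: Fus AF i iA.
  exact: Fus BF i iA.
have /tuple_uniqP inj : uniq (in_tuple us) by [].
have TT : restriction us [set tnth (in_tuple us) j | j in T] = T.
  by apply/setP => j; rewrite inE mem_imset.
exists [set tnth (in_tuple us) j | j in T]; last exact: leq_trans (leq_imset_card _ _) Tk.
move=> A B AF BF AB /(congr1 (restriction us)); rewrite !restrictionI TT.
apply: trT; rewrite ?imset_f // => /restriction_inj eqAB; apply: AB.
by apply: eqAB; exact: Fus.
Qed.

Lemma mem_points_in n (U : {set 'I_n}) i : (i \in points_in U) = (i \in U).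
Proof. by rewrite mem_rev mem_filter mem_enum andbT. Qed.

Lemma uniq_points_in n (U : {set 'I_n}) : uniq (points_in U).
Proof. by rewrite rev_uniq filter_uniq ?enum_uniq. Qed.

Lemma card_bigcup_leq (X : finType) (r : seq {set X}) d :
  (forall A, A \in r -> #|A| <= d) -> #|\bigcup_(A <- r) A| <= size r * d.
Proof.
elim: r => [|A r IH] rd; first by rewrite big_nil cards0.
rewrite big_cons mulSn; apply: leq_trans (leq_card_setU _ _) _.
rewrite leq_add ?rd ?mem_head // IH // => B Br; apply: rd.
by rewrite in_cons Br orbT.
Qed.

(** * Sizes of codes *)

Lemma tsize_code_seq_geq l : size l <= tsize (code_seq l).
Proof. by elim: l => //= x l IH; rewrite ltnS; apply: leq_trans IH (leq_addl _ _). Qed.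

Lemma tsize_code_seq_leq B l : all (fun x => tsize x <= B) l ->
  tsize (code_seq l) <= size l * B.+1 + 1.
Proof. by elim: l => //= x l IH /andP[xB /IH]; rewrite mulSn; lia. Qed.

Lemma tsize_code_nat n : tsize (code_nat n) <= n * 2 + 1.
Proof.
rewrite -[n in n * 2](size_nseq n Nil); apply: tsize_code_seq_leq.
by rewrite all_nseq orbT.
Qed.

(** A true bit takes three nodes, and the list cell holding it a fourth. *)
Lemma tsize_bits n (A : {set 'I_n}) l : tsize (bits A l) <= size l * 4 + 1.
Proof.
rewrite -[size l](size_map (fun i => code_bool (i \in A))).
by apply: tsize_code_seq_leq; rewrite all_map; apply/allP => i _ /=; case: (_ \in _).
Qed.

(** * Closure properties of polynomial bounds *)

Definition polynomial (f : nat -> nat) : Prop :=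
  exists p : {poly nat}, forall x, f x = p.[x]%R.

Lemma polynomial_const c : polynomial (fun=> c).
Proof. by exists c%:P%R => x; rewrite hornerC. Qed.

Lemma polynomial_id : polynomial id.
Proof. by exists 'X%R => x; rewrite hornerX. Qed.

Lemma polynomialD f g : polynomial f -> polynomial g -> polynomial (fun x => f x + g x).
Proof. by move=> [p fp] [q gq]; exists (p + q)%R => x; rewrite hornerD -fp -gq. Qed.

Lemma polynomialM f g : polynomial f -> polynomial g -> polynomial (fun x => f x * g x).
Proof. by move=> [p fp] [q gq]; exists (p * q)%R => x; rewrite hornerM -fp -gq. Qed.

Lemma polynomialX f d : polynomial f -> polynomial (fun x => f x ^ d).
Proof.
move=> pf; elim: d => [|d [p fp]]; first exact: polynomial_const.
have [q fq] := polynomialM pf (ex_intro _ p fp).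
by exists q => x; rewrite expnS -fq.
Qed.

Lemma polynomial_eq f g : f =1 g -> polynomial f -> polynomial g.
Proof. by move=> fg [p fp]; exists p => x; rewrite -fg. Qed.

Lemma polynomialS f : polynomial f -> polynomial (fun x => (f x).+1).
Proof.
move=> pf; apply: (polynomial_eq (f := fun x => 1 + f x)) => //.
exact: polynomialD (polynomial_const 1) pf.
Qed.

Ltac polynomial :=
  repeat first [exact: polynomial_const | exact: polynomial_id
    | apply: polynomialS | apply: polynomialD | apply: polynomialM | apply: polynomialX].

(** * Both algorithms on coded instances *)

Lemma wp_runs c x (Q : nat -> store -> Prop) :
    (forall s, s 0 = x -> wp c s Q) ->
  exists t s, runs c x t (s 0) /\ Q t s.
Proof.
move=> /(_ [fun _ : nat => Nil with 0 |-> x] erefl)[t [s [ex q]]].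
by exists t, s; split=> //; exists s.
Qed.

(** With budget 0 this is the constant no-instance output for oversized families; its larger member
    is a singleton, within the bound as [d] is positive. *)
Definition no_family : {set {set 'I_1}} := [set set0; [set: 'I_1]].

Lemma no_family_bound d : 1 <= d -> forall A, A \in no_family -> #|A| <= d.
Proof. by move=> d1 A; rewrite !inE => /orP[] /eqP ->; rewrite ?cards0 ?cardsT ?card_ord. Qed.

Lemma no_family_tracking T : tracking no_family T -> 0 < #|T|.
Proof.
move=> trT; rewrite lt0n cards_eq0; apply/eqP => T0.
apply: (trT set0 [set: 'I_1]); rewrite ?inE ?eqxx ?orbT ?T0 ?setI0 //.
by move/setP/(_ ord0); rewrite !inE.
Qed.

Ltac monotone := repeat first [by [] | apply: leq_add | apply: leq_mul].

Lemma kernel_time_leq d n m k N : n <= N -> m <= N -> k <= N ->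
  kernel_time d n m k <= kernel_time d N N N.
Proof.
move=> nN mN kN; have kNd : k.+1 ^ d <= N.+1 ^ d by case: (d) => // e; rewrite leq_exp2r.
by rewrite /kernel_time; monotone.
Qed.

Lemma branching_step_leq n m N : n <= N -> m <= N ->
  branching_step n m <= branching_step N N.
Proof. by move=> nN mN; rewrite /branching_step; monotone. Qed.

(** Thanks to the unary coding, the ground set, the family and the budget are all bounded by the
    size of the code, so bounds in them become polynomial in [tsize x]. *)
Lemma tracking_code_inv d (I : tracking_instance d) x : tracking_code I x ->
  exists r, [/\ x = Cons (code_nat (points I)) (Cons (rows r) (code_nat (budget I))),
    uniq r, r =i family I, points I <= tsize x & size r <= tsize x /\ budget I <= tsize x].
Proof.
case=> r perm_r x_eq; exists r; split; first exact: x_eq.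
- by rewrite (perm_uniq perm_r) enum_uniq.
- by move=> A; rewrite (perm_mem perm_r) mem_enum.
- have := tsize_code_seq_geq (nseq (points I) Nil).
  by rewrite x_eq size_nseq /= -/(code_nat _); lia.
- have := tsize_code_seq_geq [seq code_set A | A <- r].
  have := tsize_code_seq_geq (nseq (budget I) Nil).
  by rewrite x_eq size_nseq size_map /= -/(code_nat _); lia.
Qed.

Lemma tracking_set_kernel d : 1 <= d -> has_polynomial_kernel (tracking_set_problem d).
Proof.
move=> d1; exists (Kernel d).
have [p pE] : polynomial (fun x => kernel_time d x x x).
  by rewrite /kernel_time; polynomial.
(* At most [k.+1 ^ d] rows with at most [k.+1 ^ d * d] bits each, then the unary ground set, and
   [k * 3] for the coded budget plus the parameter. The constant also covers the fixed
   no-instance. *)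
have [q qE] : polynomial (fun k => k.+1 ^ d * (k.+1 ^ d * d * 4 + 2) +
    (k.+1 ^ d * d * 2 + k * 3 + 50)) by polynomial.
exists p, q  => -[n F Fd k] x /tracking_code_inv[r].
move=> /= [x_eq r_uniq rF nx [rx kx]].
have [t [s [run [tB y_eq]]]] := wp_runs (fun s s0 => wp_Kernel d (eq_trans s0 x_eq)).
have tp : t <= p.[tsize x]%R by rewrite -pE (leq_trans tB) ?kernel_time_leq.
case: ifP y_eq => big y_eq.
  pose I' := TrackingInstance (no_family_bound d1) 0.
  exists t, I', (s 0); split=> //=.
  - exists [:: set0; [set: 'I_1]]; last by rewrite y_eq.
    apply: uniq_perm; rewrite ?enum_uniq //=.
      rewrite inE andbT; apply/eqP => /setP/(_ ord0); by rewrite !inE.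
    by move=> A; rewrite mem_enum !inE.
  - split=> [[T trT /= Tk]|[T /no_family_tracking /= T0]]; last first.
      by rewrite leqn0 => /eqP T00; rewrite T00 in T0.
    (* A tracking set within the budget would contradict [big]. *)
    suff : size r <= k.+1 ^ d by rewrite leqNgt big.
    have <- : #|F| = size r by rewrite -(eq_card rF); apply/card_uniqP.
    exact: tracking_card_leq trT Tk Fd.
  - by rewrite -qE y_eq /rows /= /code_set !enum_ordSl enum_ord0 /= !inE /=; lia.
set U := \bigcup_(A <- r) A in y_eq; set us := points_in U in y_eq.
have us_uniq : uniq us := uniq_points_in U.
have Fus A : A \in F -> {subset A <= us}.
  rewrite -rF => Ar i iA; rewrite mem_points_in.
  by rewrite /U (bigD1_seq A) //= inE iA.
have F'd A' : A' \in [set restriction us A | A in F] -> #|A'| <= d.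
  by case/imsetP=> A AF ->; exact: leq_trans (card_restriction _ us_uniq) (Fd A AF).
pose I' := TrackingInstance F'd k.
exists t, I', (s 0); split=> //=.
- exists [seq restriction us A | A <- rev r].
    apply: uniq_perm; rewrite ?enum_uniq //.
      rewrite map_inj_in_uniq ?rev_uniq // => A B.
      by rewrite !mem_rev !rF => AF BF; apply: restriction_inj; apply: Fus.
    move=> A; rewrite mem_enum; apply/mapP/imsetP => [[B]|[B]].
      by rewrite mem_rev rF; exists B.
    by exists B; rewrite // mem_rev rF.
  rewrite y_eq /= -map_comp; congr (Cons _ (Cons (code_seq _) _)).
  by apply: eq_map => A; rewrite /= code_set_restriction.
- exact: tracking_restriction.
rewrite -qE y_eq /=.
have rM : size r <= k.+1 ^ d by rewrite leqNgt big.
have usM : size us <= k.+1 ^ d * d.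
  rewrite -(card_uniqP us_uniq) (eq_card (mem_points_in U)).
  apply: (@leq_trans (size r * d)); last by rewrite leq_mul2r rM orbT.
  by apply: card_bigcup_leq => A; rewrite rF => /Fd.
have := tsize_code_nat k; have := tsize_code_nat (size us).
have := @tsize_code_seq_leq (k.+1 ^ d * d * 4 + 1) [seq bits A us | A <- rev r].
rewrite size_map size_rev all_map.
have -> : all (preim (fun A => bits A us) (fun x => tsize x <= k.+1 ^ d * d * 4 + 1)) (rev r).
  by apply/allP => A _ /=; apply: leq_trans (tsize_bits _ _) _; rewrite leq_add2r leq_mul2r usM orbT.
move=> /(_ isT) h1 h2 h3.
have : size r * (k.+1 ^ d * d * 4 + 1).+1 <= k.+1 ^ d * (k.+1 ^ d * d * 4 + 2).
  by rewrite -addn1 -addnA leq_mul.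
move=> h4; have arith a b c w z P Y : a <= w * 2 + 1 -> w <= P -> b <= z + 1 ->
    z <= Y -> c <= k * 2 + 1 ->
    (a + (b + c).+1).+1 + k <= Y + (P * 2 + k * 3 + 50) by lia.
exact: arith h2 usM h1 h4 h3.
Qed.

Lemma tracking_set_solvable : exists c : {poly nat}, forall d : nat, 1 <= d ->
  solvable_in_Ostar (tracking_set_problem d) (fun k : nat => c.[d]%R ^ k).
Proof.
have [c cE] : polynomial (fun d => 2 * d) by polynomial.
exists c => d d1; exists Branching.
(* The factor [x.+1] absorbs the number [k.+1] of levels in [nodes_leq], the budget being at most
   the size of the code. *)
have [q qE] : polynomial (fun x => x.+1 * (branching_step x x + 2) + 50).
  by rewrite /branching_step; polynomial.
exists q  => -[n F Fd k] x /tracking_code_inv[r].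
move=> /= [x_eq r_uniq rF nx [rx kx]].
have [t [s [run [tB [b y_eq yes]]]]] :=
  wp_runs (fun s s0 => wp_Branching r_uniq rF Fd (eq_trans s0 x_eq)).
exists t, b; split=> //; first by rewrite -y_eq.
rewrite -cE -qE; apply: leq_trans tB _.
have c_gt0 : 0 < (2 * d) ^ k by rewrite expn_gt0; lia.
rewrite [leqRHS]mulnDr; apply: leq_add; last by rewrite leq_pmull.
rewrite mulnA; apply: leq_mul; last by rewrite leq_add2r branching_step_leq.
apply: leq_trans (nodes_leq _ _) _; first by lia.
by rewrite mulnC leq_mul.
Qed.

Theorem theorem1 :
  (forall d : nat, 1 <= d -> has_polynomial_kernel (tracking_set_problem d)) /\
  (exists c : {poly nat}, forall d : nat, 1 <= d ->
     solvable_in_Ostar (tracking_set_problem d) (fun k : nat => c.[d]%R ^ k)).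
Proof. exact: conj tracking_set_kernel tracking_set_solvable. Qed.
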